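(* Let $\Gamma^1=(G,\sigma_1,\mu_1)$ be a $\gamma_1$-regular signed graph on $n_1$ vertices and $m_1$ edges, let $\theta$ be any $r$-orientation of the edges of $\Gamma^1$, and let $\Gamma^2=(H,\sigma_2,\mu_2)$ be an arbitrary signed graph on $n_2$ vertices. Let $\lambda_1(\Gamma^1),\dots,\lambda_{n_1}(\Gamma^1)$ be the eigenvalues of $A(\Gamma^1)$. Then $$f_{A((\Gamma^1\diamond\Gamma^2)_\theta)}(\lambda)=\big(f_{A(\Gamma^2)}(\lambda)\big)^{m_1}\prod_{j=1}^{n_1}\Big[\lambda-\lambda_j(\Gamma^1)-\big(\gamma_1+\lambda_j(\Gamma^1)\big)\Sigma_{A(\Gamma^2)}(\lambda)\Big].$$
   Context: A signed graph $\Gamma=(G,\sigma,\mu)$ has a finite simple graph $G$ with vertices $v_1,\dots,v_n$, signature $\sigma:E(G)\to\{\pm1\}$ and marking $\mu:V(G)\to\{\pm1\}$; $\mu(\Gamma)=(\mu(v_1),\dots,\mu(v_n))^T$. $A(\Gamma)$ is the $n\times n$ matrix with $(i,j)$ entry $\sigma(v_iv_j)$ if $v_i\sim v_j$ and $0$ otherwise. $\gamma$-regular means every vertex has degree $\gamma$. $f_M(\lambda)=\det(\lambda I-M)$. For a matrix $N$ associated with $\Gamma$, the signed $N$-coronal is the rational function $\Sigma_N(X)=\mu(\Gamma)^T(XI_n-N)^{-1}\mu(\Gamma)$. An $r$-orientation of $(G,\sigma)$ is a map $\theta:V(G)\times E(G)\to\{-1,0,1\}$ with $\theta(w,uv)=0$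 for $w\notin\{u,v\}$, $\theta(u,uv)\in\{\pm1\}$ at endpoints, and $\theta(u,uv)\theta(v,uv)=\sigma(uv)$. The edge corona $(\Gamma^1\diamond\Gamma^2)_\theta$ (with $E(\Gamma^1)=\{e_1,\dots,e_{m_1}\}$) is obtained from $\Gamma^1$ and $m_1$ disjoint copies of $\Gamma^2$ by joining, for each $t$, both endpoints $u$ of $e_t$ to every vertex $w$ of the $t$-th copy, the edge $uw$ having sign $\theta(u,e_t)\mu_2(w)$, where $\mu_2(w)$ is the marking of the vertex of $\Gamma^2$ corresponding to $w$. *)

(* Defs.v *)
From HB Require Import structures.
From mathcomp Require Import all_boot all_order all_algebra.

Set Implicit Arguments.
Unset Strict Implicit.
Unset Printing Implicit Defensive.

Import Order.TTheory GRing.Theory Num.Theory.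
Local Open Scope ring_scope.

(* The signature is a function of unordered pairs: [sg_sign] is symmetric on
   adjacent vertices, and its values on non-adjacent pairs are never used. *)
Record signed_graph (V : finType) := SignedGraph {
  sg_adj : rel V;
  sg_sign : V -> V -> int;
  sg_adj_sym : symmetric sg_adj;
  sg_adj_irr : irreflexive sg_adj;
  sg_sign_val : forall u v, sg_adj u v -> sg_sign u v \in [:: 1; -1];
  sg_sign_sym : forall u v, sg_adj u v -> sg_sign u v = sg_sign v u
}.

Record marked_signed_graph (V : finType) := MarkedSignedGraph {
  msg_graph :> signed_graph V;
  msg_mark : V -> int;
  msg_mark_val : forall v, msg_mark v \in [:: 1; -1]
}.

Definition edge_set (V : finType) (G : signed_graph V) : {set {set V}} :=
  [set [set p.1; p.2] | p : V * V & sg_adj G p.1 p.2].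

Definition edge (V : finType) (G : signed_graph V) :=
  {e : {set V} | e \in edge_set G}.

Definition regular (V : finType) (G : signed_graph V) (k : nat) : Prop :=
  forall v : V, #|[set u | sg_adj G v u]| = k.

(* The vertices v_1, ..., v_n are listed in the order of [enum V]. *)
Definition adjmx (R : pzRingType) (V : finType) (G : signed_graph V) :
    'M[R]_#|V| :=
  \matrix_(i, j) (if sg_adj G (enum_val i) (enum_val j)
                  then (sg_sign G (enum_val i) (enum_val j))%:~R else 0).

Definition markcol (R : pzRingType) (V : finType)
    (G : marked_signed_graph V) : 'cV[R]_#|V| :=
  \col_i (msg_mark G (enum_val i))%:~R.

Definition ratconst (R : idomainType) (c : R) : {fraction {poly R}} :=
  tofrac c%:P.

Definition ratX (R : idomainType) : {fraction {poly R}} := tofrac 'X.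

(* A rational function: the inverse is taken over the field R(X). *)
Definition coronal (R : idomainType) (V : finType)
    (G : marked_signed_graph V) (N : 'M[R]_#|V|) : {fraction {poly R}} :=
  let mu := map_mx (@ratconst R) (markcol R G) in
  (mu^T *m invmx ((ratX R)%:M - map_mx (@ratconst R) N) *m mu) 0 0.

(* The eigenvalues of M listed with algebraic multiplicity. *)
Definition eigenvalues (R : idomainType) (n : nat) (M : 'M[R]_n)
    (lam : 'I_n -> R) : Prop :=
  char_poly M = \prod_(j < n) ('X - (lam j)%:P).

Record r_orientation (V : finType) (G : signed_graph V) := ROrientation {
  ro_fun :> V -> edge G -> int;
  ro_out : forall w (e : edge G), w \notin val e -> ro_fun w e = 0;
  ro_val : forall u (e : edge G), u \in val e -> ro_fun u e \in [:: 1; -1];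
  ro_sign : forall u v (e : edge G), val e = [set u; v] ->
    ro_fun u e * ro_fun v e = sg_sign G u v
}.

Section EdgeCorona.
Variables (V1 V2 : finType).
Variables (G1 : signed_graph V1) (G2 : marked_signed_graph V2).
Variable theta : r_orientation G1.

(* [inr (t, w)] is the vertex w of the copy of G2 attached to the edge t. *)
Definition corona_vertex : finType := (V1 + edge G1 * V2)%type.

Definition corona_adj (x y : corona_vertex) : bool :=
  match x, y with
  | inl u, inl v => sg_adj G1 u v
  | inl u, inr (t, _) => u \in val t
  | inr (t, _), inl u => u \in val t
  | inr (t, w), inr (s, z) => (t == s) && sg_adj G2 w z
  end.

Definition corona_sign (x y : corona_vertex) : int :=
  match x, y with
  | inl u, inl v => sg_sign G1 u v
  | inl u, inr (t, w) => theta u t * msg_mark G2 w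
  | inr (t, w), inl u => theta u t * msg_mark G2 w
  | inr (_, w), inr (_, z) => sg_sign G2 w z
  end.

Fact corona_adj_sym : symmetric corona_adj.
Proof.
by case=> [u|[t w]] [v|[s z]] //=; rewrite 1?eq_sym sg_adj_sym.
Qed.

Fact corona_adj_irr : irreflexive corona_adj.
Proof. by case=> [u|[t w]] /=; rewrite sg_adj_irr ?andbF. Qed.

Let sign_mul (a b : int) :
  a \in [:: 1; -1] -> b \in [:: 1; -1] -> a * b \in [:: 1; -1].
Proof. by rewrite !inE => /orP[]/eqP-> /orP[]/eqP->. Qed.

Fact corona_sign_val x y :
  corona_adj x y -> corona_sign x y \in [:: 1; -1].
Proof.
case: x y => [u|[t w]] [v|[s z]] /=.
- exact: sg_sign_val.
- by move=> /ro_val h; apply: sign_mul => //; apply: msg_mark_val.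
- by move=> /ro_val h; apply: sign_mul => //; apply: msg_mark_val.
- by case/andP=> _; apply: sg_sign_val.
Qed.

Fact corona_sign_sym x y :
  corona_adj x y -> corona_sign x y = corona_sign y x.
Proof.
case: x y => [u|[t w]] [v|[s z]] //=; first exact: sg_sign_sym.
by case/andP=> _; apply: sg_sign_sym.
Qed.

Definition edge_corona : signed_graph corona_vertex :=
  SignedGraph corona_adj_sym corona_adj_irr corona_sign_val corona_sign_sym.

End EdgeCorona.

(* Main.v *)
(** Ordering the vertices of the edge corona as those of [G1] followed by the
    copies of [G2], the matrix [X I - A] is a 2x2 block matrix whose lower right
    block is [I (x) (X I - A2)] and whose off-diagonal block is [-(T (x) mu^T)],
    where [T] is the vertex-edge incidence matrix given by the orientation.  The
    Schur complement of the lower right block is [X I - A1 - s T T^T], with [s]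
    the coronal, and [T T^T = gamma1 I + A1] because [G1] is regular.  What
    remains is a determinant [det (a I - b A1)], a product over the eigenvalues
    of [A1]. *)
Require Import Defs.
From HB Require Import structures.
From mathcomp Require Import all_boot all_order all_algebra.
From mathcomp Require Import fingroup perm mxtens ring.

Set Implicit Arguments.
Unset Strict Implicit.
Unset Printing Implicit Defensive.

Import Order.TTheory GRing.Theory Num.Theory.
Local Open Scope ring_scope.

(** * Determinants of reindexed, tensor and block matrices *)

Lemma det_mxsub_bij (R : comPzRingType) (m n : nat) (g : 'I_m -> 'I_n)
    (A : 'M[R]_n) :
  bijective g -> \det (mxsub g g A) = \det A.
Proof.
move=> bg; have emn : m = n by have := bij_eq_card bg; rewrite !card_ord.
case: _ / emn in A g bg *.
(* Rows and columns undergo the same permutation, so the two signs cancel. *)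
have -> : mxsub g g A = row_perm (perm (bij_inj bg)) (col_perm (perm (bij_inj bg)) A).
  by apply/matrixP => i j; rewrite !mxE !permE.
rewrite row_permE col_permE !det_mulmx !det_perm odd_permV.
by rewrite mulrCA -signr_addb addbb mulr1.
Qed.

Lemma det_castmx (R : comPzRingType) (m n : nat) (e : m = n) (A : 'M[R]_m) :
  \det (castmx (e, e) A) = \det A.
Proof. by case: _ / e; rewrite castmx_id. Qed.

Lemma tens1mx1 (R : pzRingType) (m n : nat) :
  (1%:M : 'M[R]_m) *t (1%:M : 'M[R]_n) = 1%:M.
Proof.
apply/matrixP => i j.
case: (mxtens_indexP i) => i0 i1; case: (mxtens_indexP j) => j0 j1.
rewrite tensmxE !mxE (inj_eq (can_inj (@mxtens_indexK m n))) xpair_eqE.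
by rewrite -natrM mulnb.
Qed.

Lemma det_tens1mx (R : comPzRingType) (m n : nat) (N : 'M[R]_n) :
  \det ((1%:M : 'M[R]_m) *t N) = \det N ^+ m.
Proof.
elim: m => [|m IHm]; first by rewrite det_mx00 expr0.
rewrite -[m.+1]/(1 + m)%N scalar_mx_block tens_block_mx det_castmx.
by rewrite !tens0mx det_ublock IHm tens_scalar1mx det_castmx exprS.
Qed.

(** The block matrix factors as an upper block triangular matrix times a lower unitriangular one.
    Passing the inverse [D'] explicitly allows a tensor product to be supplied for it. *)
Lemma det_Schur_dr (R : comPzRingType) (m n : nat) (A : 'M[R]_m)
    (B : 'M[R]_(m, n)) (C : 'M[R]_(n, m)) (D D' : 'M[R]_n) :
  D *m D' = 1%:M ->
  \det (block_mx A B C D) = \det D * \det (A - B *m D' *m C).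
Proof.
move=> DD'.
have -> : block_mx A B C D =
    block_mx (A - B *m D' *m C) B 0 D *m block_mx 1%:M 0 (D' *m C) 1%:M.
  rewrite mulmx_block !mulmx1 !mulmx0 !add0r !mulmxA DD' mul1mx.
  by rewrite subrK.
by rewrite det_mulmx det_ublock det_lblock !det1 !mulr1 mulrC.
Qed.

(* [T *t u^T] reindexed, since its type has [n * 1] rows rather than [n]. *)
Definition tensrow_mx (R : pzRingType) (n m p : nat) (T : 'M[R]_(n, m))
    (u : 'cV[R]_p) : 'M[R]_(n, m * p) :=
  rowsub (fun i => mxtens_index (i, ord0)) (T *t u^T).

(** The inverse of [1%:M *t N] is [1%:M *t invmx N], so by the mixed product rule the Schur
    correction is the tensor product of [T *m T^T] with the 1x1 matrix [u^T *m invmx N *m u], that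
    is, a scalar multiple of [T *m T^T]. *)
Lemma det_block_tensrow (F : fieldType) (n m p : nat) (A : 'M[F]_n)
    (T : 'M[F]_(n, m)) (N : 'M[F]_p) (u : 'cV[F]_p) :
  N \in unitmx ->
  \det (block_mx A (- tensrow_mx T u) (- (tensrow_mx T u)^T) (1%:M *t N)) =
  \det N ^+ m * \det (A - (u^T *m invmx N *m u) 0 0 *: (T *m T^T)).
Proof.
move=> uN; have DD' : (1%:M *t N) *m (1%:M *t invmx N) = 1%:M :> 'M_(m * p).
  by rewrite tensmx_mul mulmx1 mulmxV // tens1mx1.
rewrite (det_Schur_dr _ _ _ DD') det_tens1mx; congr (_ * \det (_ - _)).
rewrite !mulNmx mulmxN opprK /tensrow_mx trmx_mxsub mul_rowsub_mx tensmx_mul.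
rewrite mulmx1 mulmx_colsub mul_rowsub_mx trmx_tens tensmx_mul trmxK.
by apply/matrixP => i j; rewrite 2!mxE tensmxE [RHS]mxE mulrC.
Qed.

(** For nonzero [b] the determinant is [b ^+ n] times the characteristic polynomial at [a / b].
    Treating [b = 0] apart means that the later choice [b = 1 + s] needs no proof of being
    nonzero. *)
Lemma det_scalar_subZ (F : fieldType) (n : nat) (A : 'M[F]_n) (l : 'I_n -> F)
    (a b : F) :
  char_poly A = \prod_(j < n) ('X - (l j)%:P) ->
  \det (a%:M - b *: A) = \prod_(j < n) (a - b * l j).
Proof.
move=> hA; have [->|b0] := eqVneq b 0.
  rewrite scale0r subr0 det_scalar.
  by under eq_bigr do rewrite mul0r subr0; rewrite prodr_const card_ord.
have -> : a%:M - b *: A = b *: ((a / b)%:M - A).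
  by rewrite scalerBr scale_scalar_mx mulrCA divff // mulr1.
rewrite detZ.
have -> : \det ((a / b)%:M - A) = (char_poly A).[a / b].
  rewrite /char_poly -horner_evalE -det_map_mx; congr (\det _).
  by apply/matrixP => i j; rewrite !mxE /= horner_evalE hornerD hornerN hornerC hornerMn hornerX.
rewrite hA horner_prod -[X in b ^+ X]card_ord -prodr_const -big_split.
by apply: eq_bigr => j _; rewrite /= !hornerE mulrBr mulrCA divff ?mulr1.
Qed.

(** * The oriented incidence matrix of a signed graph *)

Section Incidence.
Variables (V : finType) (G : signed_graph V).
Implicit Types u v : V.

Lemma edge_setP (E : {set V}) :
  reflect (exists u v, sg_adj G u v /\ E = [set u; v]) (E \in edge_set G).
Proof.
apply: (iffP imsetP) => [[[u v]] /=|[u [v [uv ->]]]].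
  by rewrite inE /= => uv ->; exists u, v.
by exists (u, v); rewrite // inE.
Qed.

Lemma mem_edge_set u v : sg_adj G u v -> [set u; v] \in edge_set G.
Proof. by move=> uv; apply/edge_setP; exists u, v. Qed.

Lemma sg_adj_neq u v : sg_adj G u v -> u != v.
Proof. by apply: contraTneq => ->; rewrite sg_adj_irr. Qed.

Lemma edge_endpoints (e : edge G) u v :
  u \in val e -> v \in val e -> u != v -> sg_adj G u v /\ val e = [set u; v].
Proof.
case/edge_setP: (valP e) => a [b [ab ->]].
rewrite !inE => /orP[]/eqP-> /orP[]/eqP->; rewrite ?eqxx // => _.
by split; rewrite 1?sg_adj_sym // setUC.
Qed.

(** The map sending [v] to [[set u; v]] is a bijection from the neighbours of [u] onto its incident
    edges. It turns regularity, a count of neighbours, into a count of edges. *)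
Lemma card_incident_edges u :
  #|[set e : edge G | u \in val e]| = #|[set v | sg_adj G u v]|.
Proof.
rewrite -(card_imset _ (val_inj : injective (val : edge G -> _))).
have inj : {in [set v | sg_adj G u v] &, injective (fun v => [set u; v])}.
  move=> v w; rewrite !inE => uv uw /setP/(_ v).
  by rewrite !inE eqxx orbT eq_sym (negPf (sg_adj_neq uv)) => /esym/eqP.
rewrite -(card_in_imset inj); apply: eq_card => E; apply/imsetP/imsetP.
  case=> e; rewrite inE => ue ->.
  case/edge_setP: (valP e) (ue) => a [b [ab ->]].
  rewrite !inE => /orP[]/eqP->; first by exists b; rewrite ?inE.
  by exists a; rewrite ?inE 1?sg_adj_sym // setUC.
case=> v; rewrite inE => uv ->.
by exists (Sub [set u; v] (mem_edge_set uv)); rewrite ?inE /= ?eqxx.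
Qed.

(** On the diagonal each incident edge contributes a square of a sign, hence 1. Off the diagonal
    only the edge [[set u; v]], if present, has both endpoint values nonzero, and their product is
    its sign. *)
Lemma orientation_dot (theta : r_orientation G) u v :
  \sum_(e : edge G) theta u e * theta v e =
  if u == v then #|[set w | sg_adj G u w]|%:R
  else if sg_adj G u v then sg_sign G u v else 0.
Proof.
have [<-|uv] := eqVneq u v.
  rewrite -card_incident_edges -sum1_card natr_sum [RHS]big_mkcond /=.
  apply: eq_bigr => e _; rewrite inE; case: ifPn => ue; last first.
    by rewrite ro_out ?mul0r.
  by have := ro_val theta ue; rewrite !inE => /orP[]/eqP->.
have off (e : edge G) : val e != [set u; v] -> theta u e * theta v e = 0.
  move=> eE; case: (boolP (u \in val e)) => ue; last by rewrite ro_out ?mul0r.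
  case: (boolP (v \in val e)) => ve; last by rewrite (ro_out _ ve) mulr0.
  by case: (edge_endpoints ue ve uv) => _ h; rewrite h eqxx in eE.
case: ifPn => adj.
  rewrite (bigD1 (Sub [set u; v] (mem_edge_set adj))) //= big1 => [|e ne].
    by rewrite addr0; apply: ro_sign.
  by apply: off; apply: contra ne => h; apply/eqP/val_inj/eqP.
apply: big1 => e _; apply: off; apply: contra adj => /eqP eE.
have ue : u \in val e by rewrite eE !inE eqxx.
have ve : v \in val e by rewrite eE !inE eqxx orbT.
by case: (edge_endpoints ue ve uv).
Qed.

Definition incmx (R : pzRingType) (theta : r_orientation G) :
    'M[R]_(#|V|, #|{: edge G}|) :=
  \matrix_(i, k) (theta (enum_val i) (enum_val k))%:~R.

Lemma incmx_mul_tr (R : pzRingType) (theta : r_orientation G) (k : nat) :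
  regular G k ->
  incmx R theta *m (incmx R theta)^T = k%:R%:M + adjmx R G.
Proof.
move=> reg; apply/matrixP => i j; rewrite !mxE.
under eq_bigr do rewrite !mxE -intrM.
rewrite -(raddf_sum (intmul (1 : R))) /=.
have := orientation_dot theta (enum_val i) (enum_val j).
rewrite (reindex (@enum_val _ {: edge G})) /=; last first.
  by exists enum_rank => e _; rewrite ?enum_valK ?enum_rankK.
move=> ->; rewrite (inj_eq enum_val_inj).
have [<-|ij] := eqVneq i j; first by rewrite sg_adj_irr addr0 mulr1n reg natz.
by rewrite mulr0n add0r; case: ifP.
Qed.

End Incidence.

(** * Block form of the adjacency matrix of the edge corona *)

Section CoronaIndex.
Variables (V1 V2 : finType) (G1 : signed_graph V1) (G2 : marked_signed_graph V2).
Variable theta : r_orientation G1.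

(** Pairs of an edge and a vertex are coded by [mxtens_index], so that the blocks involving the
    copies become literal tensor products. *)
Definition corona_index (k : 'I_(#|V1| + #|{: edge G1}| * #|V2|)) :
    'I_#|corona_vertex V2 G1| :=
  enum_rank (match split k with
    | inl i => inl (enum_val i)
    | inr l => inr (enum_val (mxtens_unindex l).1, enum_val (mxtens_unindex l).2)
    end : corona_vertex V2 G1).

Lemma corona_index_bij : bijective corona_index.
Proof.
exists (fun x => unsplit (match enum_val x with
  | inl u => inl (enum_rank u)
  | inr (e, w) => inr (mxtens_index (enum_rank e, enum_rank w))
  end)) => [k|x].
  rewrite /corona_index enum_rankK -[RHS]splitK.
  case: (split k) => l; first by rewrite enum_valK.
  by case: (mxtens_indexP l) => e w; rewrite mxtens_indexK !enum_valK.
rewrite /corona_index unsplitK; apply: enum_val_inj; rewrite enum_rankK.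
by case: (enum_val x) => [u|[e w]]; rewrite ?mxtens_indexK /= !enum_rankK.
Qed.

Lemma corona_indexl i :
  enum_val (corona_index (lshift _ i)) = inl (enum_val i).
Proof. by rewrite /corona_index enum_rankK -[lshift _ i]/(unsplit (inl i)) unsplitK. Qed.

Lemma corona_indexr k l :
  enum_val (corona_index (rshift _ (mxtens_index (k, l)))) =
  inr (enum_val k, enum_val l).
Proof.
rewrite /corona_index enum_rankK -[rshift _ _]/(unsplit (inr (mxtens_index (k, l)))).
by rewrite unsplitK mxtens_indexK.
Qed.

Lemma mxsub_corona (F : comPzRingType) (a : F) :
  mxsub corona_index corona_index (a%:M - adjmx F (edge_corona G2 theta)) =
  block_mx (a%:M - adjmx F G1)
    (- tensrow_mx (incmx F theta) (markcol F G2))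
    (- (tensrow_mx (incmx F theta) (markcol F G2))^T)
    (1%:M *t (a%:M - adjmx F G2)).
Proof.
have off u (e : edge G1) w : (if u \in val e then (theta u e * msg_mark G2 w)%:~R else 0)
    = (theta u e)%:~R * (msg_mark G2 w)%:~R :> F.
  by case: ifPn => [_|ue]; rewrite ?intrM // ro_out ?mul0r.
apply/matrixP => i j; rewrite 2![LHS]mxE [X in X + _ = _]mxE [X in _ + X = _]mxE.
rewrite [X in _ - X = _]mxE (inj_eq (bij_inj corona_index_bij)).
rewrite -[i]splitK -[j]splitK.
case: (split i) => [i'|i'] /=; case: (split j) => [j'|j'] /=.
- rewrite block_mxEul !corona_indexl /= (inj_eq (@lshift_inj _ _)).
  by rewrite !mxE.
- rewrite block_mxEur; case: (mxtens_indexP j') => k l.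
  rewrite corona_indexl corona_indexr /= eq_lrshift mulr0n add0r off.
  by rewrite !mxE !mxtens_indexK.
- rewrite block_mxEdl; case: (mxtens_indexP i') => k l.
  rewrite corona_indexl corona_indexr /= eq_rlshift mulr0n add0r off.
  by rewrite !mxE !mxtens_indexK.
rewrite block_mxEdr; case: (mxtens_indexP i') => k l.
case: (mxtens_indexP j') => k' l'.
rewrite !corona_indexr /= (inj_eq (@rshift_inj _ _)) tensmxE.
rewrite (inj_eq (can_inj (@mxtens_indexK _ _))) xpair_eqE !mxE.
rewrite (inj_eq enum_val_inj).
by case: eqP => _ /=; rewrite ?mul1r // mul0r mulr0n subr0.
Qed.

End CoronaIndex.

(** * Passage to the field of rational functions *)

Lemma map_adjmx (R S : pzRingType) (f : {rmorphism R -> S}) (V : finType)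
    (G : signed_graph V) : map_mx f (adjmx R G) = adjmx S G.
Proof. by apply/matrixP => i j; rewrite !mxE (fun_if f) rmorph_int rmorph0. Qed.

Lemma map_markcol (R S : pzRingType) (f : {rmorphism R -> S}) (V : finType)
    (G : marked_signed_graph V) : map_mx f (markcol R G) = markcol S G.
Proof. by apply/matrixP => i j; rewrite !mxE rmorph_int. Qed.

Lemma tofrac_char_poly (R : idomainType) (n : nat) (A : 'M[R]_n) :
  tofrac (char_poly A) = \det ((ratX R)%:M - map_mx (@ratconst R) A).
Proof.
rewrite /char_poly -det_map_mx; congr (\det _).
by rewrite /char_poly_mx map_mxB map_scalar_mx -map_mx_comp.
Qed.

Lemma char_poly_map_eigenvalues (R : idomainType) (S : comNzRingType)
    (f : {rmorphism R -> S}) (n : nat) (A : 'M[R]_n) (lam : 'I_n -> R) :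
  eigenvalues A lam ->
  char_poly (map_mx f A) = \prod_(j < n) ('X - (f (lam j))%:P).
Proof.
move=> hA; rewrite -map_char_poly hA rmorph_prod; apply: eq_bigr => j _.
by rewrite rmorphB /= map_polyX map_polyC.
Qed.

Theorem theorem4p1 (R : rcfType) (V1 V2 : finType)
    (G1 : marked_signed_graph V1) (G2 : marked_signed_graph V2)
    (gamma1 : nat) (theta : r_orientation G1) (lam : 'I_#|V1| -> R)
    (hreg : regular G1 gamma1)
    (hlam : eigenvalues (adjmx R G1) lam) :
  tofrac (char_poly (adjmx R (edge_corona G2 theta))) =
  tofrac (char_poly (adjmx R G2)) ^+ #|{: edge G1}| *
  \prod_(j < #|V1|)
    (ratX R - ratconst (lam j)
     - ratconst (gamma1%:R + lam j) * coronal G2 (adjmx R G2)).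
Proof.
pose f : {rmorphism R -> {fraction {poly R}}} :=
  GRing.RMorphism.clone _ _ (@tofrac {poly R} \o polyC) _.
have fE : @ratconst R = f by [].
(* The determinant is the image of a characteristic polynomial, which is monic and hence nonzero. *)
have unitN : (ratX R)%:M - adjmx _ G2 \in unitmx.
  rewrite unitmxE unitfE -(map_adjmx f) -fE -tofrac_char_poly tofrac_eq0.
  exact: monic_neq0 (char_poly_monic _).
rewrite !tofrac_char_poly fE !map_adjmx.
rewrite -(det_mxsub_bij _ (@corona_index_bij _ _ _)) mxsub_corona.
rewrite det_block_tensrow // /coronal fE map_adjmx map_markcol.
set s := (_ *m _) 0 0; congr (_ * _).
rewrite (incmx_mul_tr _ _ hreg).
(* Collecting the scalar part and the multiple of the adjacency matrix gives the shape
   [a%:M - b *: A]; each factor [a - b * l j] then rearranges to the one claimed. *)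
have -> : (ratX R)%:M - adjmx _ G1 - s *: (gamma1%:R%:M + adjmx _ G1) =
    (ratX R - s * gamma1%:R)%:M - (1 + s) *: adjmx _ G1.
  rewrite scalerDr scale_scalar_mx scalerDl scale1r raddfB /= !opprD !addrA.
  by congr (_ - _); rewrite addrAC.
have := char_poly_map_eigenvalues f hlam.
rewrite map_adjmx => /det_scalar_subZ ->; apply: eq_bigr => j _.
by rewrite rmorphD rmorph_nat; ring.
Qed.
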